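(* Let $X$ be a separable Fréchet space. Denote by $\mathcal{D}$ the set of all completely admissible sequences $\alpha=(\alpha_k)_{k\geq 1}$ such that $\alpha \lesssim \mathcal{D}_s$ for some $s \in \mathbb{N}$. If a sequence $\mathcal{T}=(T_n)_{n\in\mathbb{N}}$ of continuous linear operators on $X$ satisfies the Frequent Universality Criterion, then $$\bigcap_{\alpha \in \mathcal{D}}\mathcal{F}\mathcal{U}_{\alpha}(\mathcal{T})\neq \emptyset.$$
   Context: $\mathbb{N}=\{0,1,2,\ldots\}$. A sequence $\alpha=(\alpha_k)_{k\geq 1}$ of non-negative real numbers is completely admissible if: $\sum_{k\geq 1}\alpha_k=+\infty$; $\alpha$ is non-decreasing; and $\alpha_n/\big(\sum_{j=1}^n\alpha_j\big)\to 0$ as $n\to\infty$. For two sequences, $\alpha\lesssim\beta$ means that there is $k_0\in\mathbb{N}$ such that $(\alpha_k/\beta_k)_{k\geq k_0}$ is non-increasing. For $s\in\mathbb{N}$, $\mathcal{D}_s=(\exp(k/\log_{(s)}(k)))_{k\geq k_0}$ with $k_0$ large enough, where $\log_{(s)}=\log\circ\cdots\circ\log$ ($s$ times) and $\log_{(0)}(x)=x$. The lower $\alpha$-density of $E\subset\mathbb{N}$ is $\underline{d}_\alpha(E)=\liminf_{n\to\infty}\frac{\sum_{k=1}^n\alpha_k\mathbf{1}_E(k)}{\sum_{j=1}^n\alpha_j}$. $\mathcal{FU}_\alpha(\mathcal{T})$ is the set of $\alpha$-frequently universal vectors for $\mathcal{T}$: those $x\in X$ such that $\underline{d}_\alpha(\{n\in\mathbb{N}:T_n(x)\in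 U\})>0$ for every non-empty open $U\subset X$. $\mathcal{T}=(T_n)_{n\in\mathbb{N}}$ satisfies the Frequent Universality Criterion if there exist a dense subset $Y_0$ of $X$ and mappings $S_n:Y_0\to X$, $n\in\mathbb{N}$, such that for every $y\in Y_0$: the series $\sum_{0\leq n\leq m}T_m(S_{m-n}(y))$ converges unconditionally, uniformly for $m\in\mathbb{N}$; the series $\sum_{n\geq 0}T_m(S_{m+n}(y))$ converges unconditionally, uniformly for $m\in\mathbb{N}$; the series $\sum_{n\geq 0}S_n(y)$ converges unconditionally; and $T_n(S_n(y))\to y$ as $n\to\infty$. Here, with $\Vert\cdot\Vert$ an $F$-norm defining the topology of $X$, $\sum_n x_{m,n}$ converges unconditionally, uniformly for $m$, if for every $\varepsilon>0$ there is $N$ such that $\Vert\sum_{n\in F}x_{m,n}\Vert<\varepsilon$ for every finite $F\subset\{N,N+1,\ldots\}$ and every $m$ (terms with $n$ outside the indicated range are $0$). *)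

(* Defs.v *)
From HB Require Import structures.
From mathcomp Require Import all_boot all_order all_algebra finmap.
From mathcomp Require Import all_classical all_reals all_analysis.
From mathcomp.real_closed Require Import complex.

Set Implicit Arguments.
Unset Strict Implicit.
Unset Printing Implicit Defensive.

Import Order.TTheory GRing.Theory Num.Theory.
Import numFieldNormedType.Exports.

Local Open Scope classical_set_scope.
Local Open Scope ring_scope.

Inductive ground_field := RealScalars | ComplexScalars.

Definition scalars (R : realType) (k : ground_field) : numFieldType :=
  if k is RealScalars then R : numFieldType else (R[i] : numFieldType).

Section FrechetSpaces.
Context {R : realType} {K : numFieldType} {X : tvsType K}.
Implicit Types (d : X -> X -> R) (N : X -> R).

Definition is_metric d : Prop :=
  [/\ forall x y, 0 <= d x y,
      forall x y, d x y = 0 <-> x = y,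
      forall x y, d x y = d y x &
      forall x y z, d x z <= d x y + d y z].

Definition translation_invariant d : Prop :=
  forall x y z, d (x + z) (y + z) = d x y.

Definition induces_topology d : Prop :=
  forall x : X, nbhs x = nbhs_ball_ (fun y e => [set z | d y z < e]) x.

Definition complete_metric d : Prop :=
  forall u : nat -> X,
    (forall e : R, 0 < e -> exists n0 : nat,
       forall m n : nat, (n0 <= m)%N -> (n0 <= n)%N -> d (u m) (u n) < e) ->
    exists l : X, u @ \oo --> l.

Definition is_F_norm N : Prop :=
  [/\ forall x, 0 <= N x,
      forall x, N x = 0 <-> x = 0,
      forall x y, N (x + y) <= N x + N y,
      forall (a : K) x, `|a| <= 1 -> N (a *: x) <= N x &
      forall x, N (a *: x) @[a --> (0 : K)] --> (0 : R)].

Definition F_norm_defining_topology N : Prop :=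
  is_F_norm N /\ induces_topology (fun x y => N (x - y)).

End FrechetSpaces.

(* Local convexity is part of tvsType. Completeness is that of an invariant
   metric: the uniform structure carried by a tvsType is only required to be
   compatible with the topology, so its own completeness is not the usual one. *)
Definition frechet_space (R : realType) (K : numFieldType) (X : tvsType K) :
    Prop :=
  exists d : X -> X -> R,
    [/\ is_metric d, translation_invariant d, induces_topology d &
        complete_metric d].

Definition separable (X : topologicalType) : Prop :=
  exists2 A : set X, countable A & dense A.

(* A sequence (alpha_k)_{k >= 1} is a function on nat whose value at 0 is
   irrelevant: it is never used below. *)
Section WeightSequences.
Context {R : realType}.
Implicit Types (alpha beta : nat -> R) (E : set nat).

Definition weight_sum alpha (n : nat) : R := \sum_(1 <= k < n.+1) alpha k.

Definition completely_admissible alpha : Prop :=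
  [/\ forall k : nat, (1 <= k)%N -> 0 <= alpha k,
      weight_sum alpha n @[n --> \oo] --> +oo,
      forall j k : nat, (1 <= j)%N -> (j <= k)%N -> alpha j <= alpha k &
      alpha n / weight_sum alpha n @[n --> \oo] --> (0 : R)].

Definition seq_lesssim alpha beta : Prop :=
  exists k0 : nat, forall j k : nat,
    (1 <= j)%N -> (k0 <= j)%N -> (j <= k)%N ->
    alpha k / beta k <= alpha j / beta j.

(* For small k the iterated logarithm takes junk values; only large k matter
   in seq_lesssim, whose index k0 may be increased. *)
Definition D_seq (s k : nat) : R := expR (k%:R / iter s (@ln R) k%:R).

Definition D_family : set (nat -> R) :=
  [set alpha | completely_admissible alpha /\
               exists s : nat, seq_lesssim alpha (D_seq s)].

Definition lower_density alpha E : \bar R :=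
  limn_einf (fun n =>
    ((\sum_(1 <= k < n.+1) alpha k * \1_E k) / weight_sum alpha n)%:E).

End WeightSequences.

Definition freq_universal (R : realType) (X : topologicalType)
    (alpha : nat -> R) (T : nat -> X -> X) : set X :=
  [set x | forall U : set X, open U -> U !=set0 ->
    (0 < lower_density alpha [set n | U (T n x)])%E].

Section FrequentUniversalityCriterion.
Context {R : realType} {X : topologicalZmodType}.
Variable N : X -> R.

Definition uncond_cvg_uniformly (x : nat -> nat -> X) : Prop :=
  forall e : R, 0 < e -> exists n0 : nat,
    forall F : {fset nat}, (forall n, n \in F -> (n0 <= n)%N) ->
    forall m : nat, N (\sum_(n <- F) x m n) < e.

Definition uncond_cvg (x : nat -> X) : Prop :=
  uncond_cvg_uniformly (fun _ => x).

(* The maps S n are only ever applied to points of Y0. *)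
Definition frequent_universality_criterion (T : nat -> X -> X) : Prop :=
  exists (Y0 : set X) (S : nat -> X -> X), dense Y0 /\
    forall y, Y0 y ->
      [/\ uncond_cvg_uniformly
            (fun m n => if (n <= m)%N then T m (S (m - n)%N y) else 0),
          uncond_cvg_uniformly (fun m n => T m (S (m + n)%N y)),
          uncond_cvg (fun n => S n y) &
          T n (S n y) @[n --> \oo] --> y].

End FrequentUniversalityCriterion.

(* Main.v *)
Require Import Defs.
From HB Require Import structures.
From mathcomp Require Import all_boot all_order all_algebra finmap.
From mathcomp Require Import all_classical all_reals all_analysis.
From mathcomp Require Import zify lra.

Set Implicit Arguments.
Unset Strict Implicit.
Unset Printing Implicit Defensive.

Import Order.TTheory GRing.Theory Num.Theory.
Import numFieldNormedType.Exports.

Local Open Scope classical_set_scope.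
Local Open Scope ring_scope.

(** The vector is the classical sum x = sum_p sum_(k in E p) S_k y_p, where
  (y_p) is a sequence in Y0 that is dense in X and the sets E p of natural
  numbers are disjoint and so sparse relative to one another that, for n in
  E p, every term of T_n x other than T_n S_n y_p ~ y_p falls in a tail of one
  of the series of the criterion. Then T_n x is within 6 / 2^p of y_p for all
  n in E p ([universal_vector]), and since every non-empty open set contains
  such a neighbourhood of some y_p, it is enough that every E p has positive
  lower alpha-density for all the weights alpha at once.

  The weight exp (k / log_(s) k) changes by a factor at most e on a window of
  left end k and length at most log_(s) k. So does every alpha that grows more
  slowly. Hence a set has positive lower density for all these alpha as soon
  as, for each s, every large enough n is the right end of such a window in
  which the set has a proportion of elements bounded below by a constant
  independent of n and s: the windows are stacked below n by strong induction
  ([short_windows_weight]). No set E p can have bounded gaps, because the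
  separation from E q that is imposed on it grows without control with q; but
  its gaps may grow more slowly than every iterated logarithm.

  Such sets are obtained by delaying E q ([exists_separated_sets]). The set
  E q consists of multiples of a period P_q, and it is only after a huge
  starting time t_q that the sets E p with p < q have to keep away from the
  multiples of P_q. Between t_r and t_(r+1) everything is periodic of period
  P_r, and t_r is chosen so large that windows of length 2 P_r are short
  there in the sense of log_(s) for every s <= r. The periods grow so fast
  that at most half of the multiples of P_p are lost to the later sets. *)

(** * Sets that fill short windows *)

(** A window of length w counts as short at level s when its left end is at
  least g s w. The constant C must not depend on s:
  it is the inverse of a density, while the window length w may be unbounded
  as n grows. *)
Definition fills_short_windows (g : nat -> nat -> nat) (E : set nat) : Prop :=
  exists C : nat, forall s, exists n0, forall n, (n0 <= n)%N ->
    exists w, [/\ (0 < w)%N, (g s w + w <= n)%N &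
      (w <= C * \sum_(n - w <= k < n) (k \in E))%N].

Lemma fills_short_windowsW (g : nat -> nat -> nat) (E F : set nat) :
  E `<=` F -> fills_short_windows g E -> fills_short_windows g F.
Proof.
move=> EF [C hC]; exists C => s; have [n0 hn0] := hC s; exists n0 => n /hn0.
move=> [w [w0 wn wC]]; exists w; split => //; apply: leq_trans wC _.
rewrite leq_mul2l leq_sum ?orbT // => k _.
by case: (boolP (k \in E)) => // /set_mem /EF kF; rewrite (mem_set kF).
Qed.

(** * Construction of the separated sets *)

Section SeparatedSets.
Local Open Scope nat_scope.
Variables (N : nat -> nat) (g : nat -> nat -> nat).
Hypothesis N_gt0 : forall p, 0 < N p.

(** The factor 2 (r + 2)^2 makes the fraction of blocks that fall in a margin
  of the next period equal to 1 / (r + 2)^2, and the product of the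
  1 - 1 / (r + 2)^2 telescopes to a positive limit. *)
Fixpoint period r :=
  if r is r'.+1 then 2 * (r' + 2) ^ 2 * N r * period r' else N 0.

(** Half-width of the zone around the multiples of [period q] that lower
  levels avoid. It is at least N q, and is taken to be a multiple of the
  preceding period so that zones are unions of whole blocks. *)
Definition margin q := N q * period q.-1.

Definition central q n := margin q <= n %% period q < period q - margin q.

(** The sum of the g s and the summand 2 * period r make the windows of length
  2 * period r whose right end is at least start r short at all levels s <= r;
  N r is the separation due to level r; the last term keeps these windows to
  the right of twice the preceding starting time. *)
Fixpoint start r :=
  \sum_(s < r.+1) g s (2 * period r) + 2 * period r + N r +
  (if r is r'.+1 then 2 * start r' else 0).

(** Points of level q begin at 2 * start q although lower levels avoid them
  from start q on: this buffer separates the points of level q from those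
  lower points that are too early to avoid anything. *)
Definition level p : set nat :=
  [set n | [/\ 2 * start p <= n, period p %| n &
              forall q, p < q -> start q <= n -> central q n]].

Lemma period_gt0 r : 0 < period r.
Proof. by elim: r => [|r ih]; rewrite /= ?muln_gt0 ?ih ?N_gt0 //; lia. Qed.

Lemma period_dvd r q : r <= q -> period r %| period q.
Proof.
elim: q => [|q ih]; first by rewrite leqn0 => /eqP ->.
rewrite leq_eqVlt => /orP[/eqP -> //|/ih h].
by apply: (dvdn_trans h); rewrite /= dvdn_mull.
Qed.

Lemma N_le_period r : N r <= period r.
Proof.
case: r => [|r] //=; have := period_gt0 r.
by rewrite -mulnn; nia.
Qed.

Lemma N_le_margin r : N r <= margin r.
Proof. by rewrite /margin leq_pmulr // period_gt0. Qed.

Lemma startS r : 2 * start r + 2 * period r.+1 <= start r.+1.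
Proof. by rewrite /=; lia. Qed.

Lemma start_incr r : start r < start r.+1.
Proof. by have := startS r; have := period_gt0 r.+1; lia. Qed.

Lemma start_mono r q : r <= q -> start r <= start q.
Proof.
elim: q => [|q ih]; first by rewrite leqn0 => /eqP ->.
rewrite leq_eqVlt => /orP[/eqP -> //|/ih h].
by have := start_incr q; lia.
Qed.

Lemma N_le_start r : N r <= start r.
Proof. by case: r => [|r] /=; lia. Qed.

Lemma g_le_start s r : s <= r -> g s (2 * period r) + 2 * period r <= start r.
Proof.
move=> sr; have sr' : s < r.+1 by [].
have : g s (2 * period r) <= \sum_(s < r.+1) g s (2 * period r).
  by rewrite (bigD1 (Ordinal sr')) //= leq_addr.
by case: r {sr sr'} => [|r] /=; lia.
Qed.

Lemma start_between n : start 0 <= n -> exists r, start r <= n < start r.+1.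
Proof.
elim: n => [|n ih].
  by have := N_le_start 0; have := N_gt0 0; lia.
rewrite leq_eqVlt => /orP[/eqP e|/ih[r /andP[h1 h2]]].
  by exists 0; rewrite -e leqnn start_incr.
move: h2; rewrite leq_eqVlt => /orP[/eqP e|h2].
  by exists r.+1; rewrite -e leqnn e start_incr.
by exists r; rewrite h2 (leq_trans h1).
Qed.

(** For p < q: either n is a point of level p that already avoids the
  multiples of [period q], or it is smaller than start q, while m is at least
  twice that. *)
Lemma level_separated (p q n m : nat) : p <= q -> (p, n) != (q, m) ->
  level p n -> level q m -> N q <= n - m + (m - n).
Proof.
rewrite leq_eqVlt => /orP[/eqP<-|pq] ne [n0 dn cn] [m0 dm cm].
  have nm : n != m by apply: contra_neq ne => ->.
  have := N_le_period p.
  move: dn dm nm => /dvdnP[a aE] /dvdnP[b bE]; rewrite aE bE.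
  have [||->] := ltngtP a b.
  - nia.
  - nia.
  - lia.
have [nq|qn] := ltnP n (start q); first by have := N_le_start q; lia.
have /andP[c1 c2] := cn q pq qn.
have := N_le_margin q; have := divn_eq n (period q); move: dm => /dvdnP[b ->].
set d := n %/ _; set e := n %% _ in c1 c2 *.
by have [] := ltnP d b; nia.
Qed.

(** Membership in [level p] as it reads in the range where exactly the levels
  up to r have to be avoided. It is periodic of period [period r]. *)
Definition central_upto p r n :=
  (period p %| n) && all (fun q => central q n) (iota p.+1 (r - p)).

Lemma central_upto_level p r n : p <= r -> 2 * start p <= n -> n < start r.+1 ->
  central_upto p r n -> level p n.
Proof.
move=> pr n1 n2 /andP[dn /allP a]; split => // q pq qn; apply: a.
rewrite mem_iota; have : q <= r; last by lia.
by rewrite leqNgt; apply/negP => /start_mono; lia.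
Qed.

Lemma sum_consecutive_blocks (f : nat -> nat) x P b :
  \sum_(x <= n < x + b * P) f n =
  \sum_(0 <= i < b) \sum_(x + i * P <= n < x + i.+1 * P) f n.
Proof.
elim: b => [|b ih]; first by rewrite mul0n addn0 !big_geq.
by rewrite big_nat_recr //= -ih -big_cat_nat //=; lia.
Qed.

(** Lower bound for the number of points of [central_upto p (p + i)] in a
  block of length [period (p + i)]. With a = N (p + i) and r = p + i - 1, a
  block is divided into 2 (r + 2)^2 a smaller ones, of which the margins
  cover 2 a, and 2 (r + 2)^2 a - 2 a = 2 a (r + 1) (r + 3). *)
Fixpoint central_count p i :=
  if i is i'.+1 then
    2 * N (p + i) * ((p + i') + 1) * ((p + i') + 3) * central_count p i'
  else 1.

Lemma central_count_le p i x : period (p + i) %| x ->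
  central_count p i <= \sum_(x <= n < x + period (p + i)) central_upto p (p + i) n.
Proof.
elim: i x => [|i ih] x.
  rewrite addn0 => dx; rewrite big_ltn ?leq_addr //=; last first.
    by have := period_gt0 p; lia.
  by rewrite /central_upto dx subnn.
rewrite addnS => dx; set r := p + i in ih dx *.
have P0 := period_gt0 r.
pose a := N r.+1.
have pE : period r.+1 = 2 * (r + 2) ^ 2 * a * period r by [].
pose b := 2 * (r + 2) ^ 2 * a.
have mE : margin r.+1 = a * period r by [].
rewrite pE -/b sum_consecutive_blocks.
have -> : central_count p i.+1 = 2 * a * (r + 1) * (r + 3) * central_count p i.
  by rewrite /= addnS.
have -> : 2 * a * (r + 1) * (r + 3) = b - a - a by rewrite /b -mulnn; nia.
have ab : a <= b - a by rewrite /b -mulnn; nia.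
rewrite [leqRHS](@big_cat_nat _ _ _ a) //=; last by lia.
rewrite [in leqRHS](@big_cat_nat _ _ _ (b - a) a) //=; last by lia.
rewrite -sum_nat_const_nat.
apply: (@leq_trans (\sum_(a <= j < b - a)
  \sum_(x + j * period r <= n < x + j.+1 * period r)
    central_upto p r.+1 n)); last by lia.
rewrite big_nat_cond [leqRHS]big_nat_cond leq_sum // => j /andP[/andP[j1 j2] _].
have dxr : period r %| x + j * period r.
  rewrite dvdn_add ?dvdn_mull //; apply: dvdn_trans dx.
  by rewrite period_dvd.
apply: leq_trans (ih _ dxr) _.
have -> : x + j.+1 * period r = x + j * period r + period r by lia.
rewrite big_nat_cond [leqRHS]big_nat_cond leq_sum // => n /andP[/andP[n1 n2] _].
rewrite /central_upto; case: (_ %| n) => //=.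
have -> : r.+1 - p = (r - p).+1 by rewrite /r; lia.
rewrite -[(r - p).+1]addn1 iotaD all_cat /=.
case: all => //=; rewrite andbT.
have -> : p.+1 + (r - p) = r.+1 by rewrite /r; lia.
suff -> : central r.+1 n by [].
have nE : n %% period r.+1 = n - x.
  move: dx => /dvdnP[y xE].
  have -> : n = y * period r.+1 + (n - x) by rewrite -xE; lia.
  rewrite modnMDl modn_small ?xE; first by rewrite addKn.
  by rewrite pE -/b; nia.
rewrite /central nE mE pE -/b -mulnBl.
have h1 : a * period r <= j * period r by rewrite leq_mul2r j1 orbT.
have h2 : j.+1 * period r <= (b - a) * period r by rewrite leq_mul2r j2 orbT.
by move: h1 h2 n1 n2; rewrite mulSn; clear; lia.
Qed.

(** The density central_count / period decreases at each step by the factor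
  (r + 1) (r + 3) / (r + 2)^2, so its quotient by (r + 2) / (r + 1) is
  constant; hence the density is at least (p + 1) / (p + 2) times its initial
  value 1 / period p, and (p + 1) / (p + 2) >= 1 / 2. *)
Lemma central_count_density p i :
  period (p + i) * (p + i + 2) <= 2 * period p * central_count p i * (p + i + 1).
Proof.
elim: i => [|i ih]; first by rewrite addn0 /=; nia.
have e : p + i.+1 = (p + i).+1 by rewrite addnS.
rewrite /= !e /=; set r := p + i in ih *.
have : period r * (r + 2) * (2 * (r+2) * N r.+1 * (r + 3)) <=
   2 * period p * central_count p i * (r + 1) * (2 * (r+2) * N r.+1 * (r + 3)).
  by rewrite leq_mul2r ih orbT.
by rewrite -mulnn; lia.
Qed.

(** If start r <= n < start r.+1, the window of length 2 * period r that ends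
  at n contains a whole block of length [period r], whose density is
  controlled. Part of the window may lie before start r, where fewer levels
  are to be avoided: that only adds points. *)
Lemma level_fills p : fills_short_windows g (level p).
Proof.
exists (4 * period p) => s; exists (start (maxn s p.+1)) => n n0.
have [r /andP[r1 r2]] : exists r, start r <= n < start r.+1.
  by apply: start_between; apply: leq_trans n0; apply: start_mono.
have : maxn s p.+1 <= r.
  by rewrite leqNgt; apply/negP => /start_mono; lia.
rewrite geq_max => /andP[sr pr].
have P0 := period_gt0 r.
exists (2 * period r); split; first by lia.
  by have := g_le_start sr; lia.
have big_n : 2 * start p + 2 * period r <= n.
  case: r => [|r] // in r1 r2 sr pr P0 *.
  by have := startS r; have := start_mono (pr : p <= r); lia.
pose y := n %/ period r; have yE := divn_eq n (period r).
have ltm := ltn_pmod n P0.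
rewrite -/y in yE.
(* the last block that ends at or before n *)
pose x := (y - 1) * period r.
have y0 : 0 < y by case: (posnP y) yE => // ->; lia.
have xE : x + period r = y * period r by rewrite /x -mulSnr; congr (_ * _); lia.
have h1 : central_count p (r - p) <= \sum_(n - 2 * period r <= k < n) (k \in level p).
  have e : p + (r - p) = r by lia.
  have dx : period (p + (r - p)) %| x by rewrite e dvdn_mull.
  apply: leq_trans (central_count_le dx) _; rewrite e.
  rewrite [leqRHS](@big_cat_nat _ _ _ x) /=; try lia.
  rewrite [in leqRHS](@big_cat_nat _ _ _ (x + period r) x) /=; try lia.
  apply: (@leq_trans (\sum_(x <= i < x + period r) (i \in level p))); last by lia.
  rewrite big_nat_cond [leqRHS]big_nat_cond leq_sum // => k /andP[/andP[k1 k2] _].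
  have [h|//] := boolP (central_upto p r k).
  suff -> : k \in level p by [].
  by rewrite inE; apply: (@central_upto_level p r); lia.
have := central_count_density p (r - p).
have -> : p + (r - p) = r by lia.
move: h1; set c := central_count _ _; set S := (\sum_(_ <= _ < _) _).
move=> cS h2.
have : period r <= 2 * period p * c.
  by rewrite -(@leq_pmul2r (r + 1)) ?addn1 //; nia.
nia.
Qed.

Lemma exists_separated_sets : exists E : nat -> set nat,
  [/\ forall p n, E p n -> N p <= n,
      forall p q n m, (p, n) <> (q, m) -> E p n -> E q m ->
        N (maxn p q) <= n - m + (m - n) &
      forall p, fills_short_windows g (E p)].
Proof.
exists level; split; last exact: level_fills.
- by move=> p n [n0 _ _]; have := N_le_start p; lia.
move=> p q n m /eqP ne pn qm; have [pq|/ltnW qp] := leqP p q.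
  exact: (level_separated pq ne).
by rewrite addnC; apply: (level_separated qp) => //; rewrite eq_sym.
Qed.

End SeparatedSets.

(** * Lower densities of sets that fill short windows *)

Lemma iter_ln_eventually (R : realType) (s : nat) (B : R) :
  exists A : R, forall x y, A <= x -> x <= y ->
    B <= iter s (@ln R) x <= iter s (@ln R) y.
Proof.
elim: s B => [|s ih] B; first by exists B => x y /= -> ->.
have [A hA] := ih (expR B).
exists A => x y Ax xy; rewrite !iterS.
have /andP[h1 h2] := hA x y Ax xy.
have p1 := lt_le_trans (expR_gt0 B) h1.
have p2 := lt_le_trans p1 h2.
by rewrite -{1}[B]expRK !ler_ln ?posrE ?expR_gt0 // h1.
Qed.

(** The level i plays two roles at once: it bounds the number of logarithms
  and, through i <= j, it lets windows be pushed past any prescribed rank. *)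
Definition log_threshold (R : realType) (g : nat -> nat -> nat) : Prop :=
  forall i s w j k, (s <= i)%N -> (g i w <= j)%N -> (j <= k)%N ->
    (i <= j)%N /\
    w%:R <= iter s (@ln R) j%:R <= iter s (@ln R) k%:R.

Lemma exists_log_threshold (R : realType) : exists g, log_threshold R g.
Proof.
have /choice[h hP] : forall sw : nat * nat, exists m : nat,
    forall j k : nat, (m <= j)%N -> (j <= k)%N ->
      sw.2%:R <= iter sw.1 (@ln R) j%:R <= iter sw.1 (@ln R) k%:R.
  move=> [s w]; have [A hA] := iter_ln_eventually s (w%:R : R).
  exists (Num.truncn A).+1 => j k mj jk; apply: hA; last by rewrite ler_nat.
  apply: ltW; apply: lt_le_trans (truncnS_gt A) _.
  by rewrite ler_nat.
exists (fun i w => i + \sum_(s < i.+1) h (s : nat, w))%N => i s w j k si gj jk.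
split; first by apply: leq_trans gj; exact: leq_addr.
apply: (hP (s, w)) => //; apply: leq_trans gj.
by rewrite (bigD1 (Ordinal (si : (s < i.+1)%N))) //= addnCA leq_addr.
Qed.

(** With L = log_(s), which increases, the exponent of D_s satisfies
  k / L k - j / L j <= (k - j) / L j, and this is at most 1 when k - j does
  not exceed L j. *)
Lemma comparable_on_short_windows (R : realType) (alpha : nat -> R) (s : nat) :
  (forall k, (1 <= k)%N -> 0 <= alpha k) -> seq_lesssim alpha (D_seq s) ->
  exists k0 : nat, forall j k : nat, (k0 <= j)%N -> (j <= k)%N ->
    (0 : R) < (k - j)%:R <= iter s (@ln R) j%:R ->
    iter s (@ln R) j%:R <= iter s (@ln R) k%:R ->
    alpha k <= expR 1 * alpha j.
Proof.
move=> a0 [k0 hk]; exists (maxn 1 k0) => j k; rewrite geq_max => /andP[j1 kj] jk.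
case/andP => kj0 lj lk.
have := hk j k j1 kj jk; rewrite /D_seq.
set L := iter s _ _ in lj lk *; set L' := iter s _ _ in lk *.
have L0 : 0 < L := lt_le_trans kj0 lj.
have L'0 : 0 < L' := lt_le_trans L0 lk.
rewrite ler_pdivrMr ?expR_gt0 // => /le_trans; apply.
rewrite mulrAC -mulrA mulrC ler_wpM2r ?a0 // -expRN -expRD ler_expR.
rewrite [leRHS](_ : 1 = L / L); last by rewrite divff // gt_eqF.
apply: (@le_trans _ _ (k%:R / L - j%:R / L)).
  by rewrite lerB // ler_wpM2l // lef_pV2.
by rewrite -mulrBl ler_wpM2r ?invr_ge0 ?(ltW L0) // -natrB.
Qed.

Lemma limn_einf_ge (R : realType) (u : nat -> \bar R) (c : \bar R) n0 :
  (forall n, (n0 <= n)%N -> (c <= u n)%E) -> (c <= limn_einf u)%E.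
Proof.
move=> h; rewrite limn_einf_lim; apply: lime_ge; first exact: is_cvg_einfs.
exists n0 => // m /= mn; apply: le_ereal_inf_tmp => _ [p /= pm] <-.
by apply: h; exact: leq_trans pm.
Qed.

(** Strong induction on n: a window of length w that ends at n has weight at
  most w * alpha n, because alpha increases, and E has at least w / C
  elements in it, each of weight at least alpha n / e. What precedes the
  window is the induction hypothesis. *)
Lemma short_windows_weight (R : realType) (g : nat -> nat -> nat)
    (alpha : nat -> R) (E : set nat) :
  log_threshold R g -> fills_short_windows g E -> D_family alpha ->
  exists (K : R) (n0 : nat), [/\ 0 < K, (0 < n0)%N & forall n,
    \sum_(n0 <= k < n) alpha k <= K * \sum_(1 <= k < n) alpha k * \1_E k].
Proof.
move=> gP [C hC] [[a0 _ amono _] [s als]].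
have [k0 hk0] := comparable_on_short_windows a0 als.
have [n0 hn0] := hC (maxn s (maxn k0 1)).
exists (C.+1%:R * expR 1), (maxn n0 1); split.
- by rewrite mulr_gt0 ?expR_gt0.
- by rewrite leq_max orbT.
elim/ltn_ind => n ih.
have [n0n|nn0] := leqP n (maxn n0 1).
  rewrite big_geq // mulr_ge0 ?mulr_ge0 ?expR_ge0 // big_nat_cond.
  by rewrite sumr_ge0 // => k /andP[/andP[k1 _] _]; rewrite mulr_ge0 ?a0 // indicE.
have [w [w0 wn wC]] : _ := hn0 n (leq_trans (leq_maxl _ _) (ltnW nn0)).
set i := maxn s _ in wn.
have giw : (g i w <= n - w)%N by lia.
have wlen : (w <= n)%N by lia.
have si : (s <= i)%N by rewrite leq_maxl.
have [inw _] := gP i s w _ _ si giw (leqnn _).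
have nw1 : (1 <= n - w)%N by move: inw; rewrite /i; lia.
have k0nw : (k0 <= n - w)%N by move: inw; rewrite /i; lia.
(* on the window, alpha does not fall below alpha n / e *)
have cmp j : (n - w <= j < n)%N -> alpha n <= expR 1 * alpha j.
  move=> /andP[j1 j2]; apply: hk0; [by lia|by lia| |].
    have [_ /andP[h _]] := gP i s w j j si (leq_trans giw j1) (leqnn _).
    by rewrite ltr0n; apply/andP; split; [lia|apply: le_trans h; rewrite ler_nat; lia].
  by have [_ /andP[_ ->]] := gP i s w j n si (leq_trans giw j1) (ltnW j2).
have ub : \sum_(maxn n0 1 <= k < n) alpha k <=
    \sum_(maxn n0 1 <= k < n - w) alpha k + w%:R * alpha n.
  have wsum m : (1 <= m)%N -> (n - w <= m)%N ->
      \sum_(m <= k < n) alpha k <= w%:R * alpha n.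
    move=> m1 nwm; apply: (@le_trans _ _ (\sum_(m <= k < n) alpha n)).
      rewrite big_nat_cond [leRHS]big_nat_cond ler_sum // => k /andP[/andP[k1 k2] _].
      by rewrite amono; lia.
    rewrite sumr_const_nat -[leLHS]mulr_natl ler_wpM2r ?ler_nat ?a0; lia.
  have [h|h] := leqP (maxn n0 1) (n - w).
    by rewrite (@big_cat_nat _ _ _ (n - w)) ?lerD2l ?wsum //=; lia.
  by rewrite [X in X + _]big_geq ?add0r ?wsum ?leq_max ?orbT //; lia.
apply: (le_trans ub).
rewrite (@big_cat_nat _ _ _ (n - w) 1) //=; last by lia.
rewrite mulrDr lerD //; first by apply: ih; lia.
apply: (@le_trans _ _ (C.+1%:R * \sum_(n - w <= k < n) alpha n * \1_E k)).
  have -> : \sum_(n - w <= k < n) alpha n * \1_E k =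
      alpha n * (\sum_(n - w <= k < n) (k \in E))%N%:R.
    by rewrite -mulr_sumr natr_sum.
  rewrite mulrCA mulrC ler_wpM2l ?a0 //; first by lia.
  rewrite -natrM ler_nat; apply: leq_trans wC _.
  by rewrite leq_mul2r leqnSn orbT.
rewrite -mulrA ler_wpM2l // mulr_sumr.
rewrite big_nat_cond [leRHS]big_nat_cond ler_sum // => k /andP[hk _].
by rewrite mulrA ler_wpM2r ?cmp // indicE.
Qed.

(** Since the total weight diverges, the part of it below n0, which the
  previous estimate ignores, is eventually at most half of the total. *)
Lemma lower_density_gt0 (R : realType) (g : nat -> nat -> nat)
    (alpha : nat -> R) (E : set nat) :
  log_threshold R g -> fills_short_windows g E -> D_family alpha ->
  (0 < lower_density alpha E)%E.
Proof.
move=> gP hE aD; have [K [n0 [K0 n00 hK]]] := short_windows_weight gP hE aD.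
have [[a0 ainfty _ _] _] := aD.
apply: (@lt_le_trans _ _ ((2 * K)^-1)%:E); first by rewrite lte_fin invr_gt0 mulr_gt0.
pose A := \sum_(1 <= k < n0) alpha k.
have A0 : 0 <= A.
  by rewrite /A big_nat_cond sumr_ge0 // => k /andP[/andP[k1 _] _]; exact: a0.
move/cvgryPge : ainfty => /(_ (2 * A + 1)) [m _ hm].
apply: (@limn_einf_ge _ _ _ (maxn m n0)) => n; rewrite geq_max => /andP[mn nn].
have hW : 2 * A + 1 <= weight_sum alpha n := hm n mn.
have W0 : 0 < weight_sum alpha n.
  by apply: lt_le_trans hW; rewrite ltr_pwDr // mulr_ge0.
rewrite lee_fin ler_pdivlMr // mulrC ler_pdivrMr ?mulr_gt0 //.
have := hK n.+1; set S := \sum_(1 <= k < n.+1) _ * _.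
have : weight_sum alpha n = A + \sum_(n0 <= k < n.+1) alpha k.
  by rewrite /weight_sum (@big_cat_nat _ _ _ n0) //=; lia.
set B := \sum_(n0 <= k < n.+1) _; move: hW; set W := weight_sum _ _ => hW WE hB.
have h : W <= 2 * (K * S) by lra.
by rewrite [leRHS]mulrC -mulrA.
Qed.

(** * F-norms *)

Section FNorm.
Context {R : realType} {K : numFieldType} {X : tvsType K}.
Variable N : X -> R.
Hypothesis N_F_norm : F_norm_defining_topology N.

Lemma F_norm0 : N 0 = 0.
Proof. by have [[_ h _ _ _] _] := N_F_norm; apply/h. Qed.

Lemma F_normD x y : N (x + y) <= N x + N y.
Proof. by have [[_ _ h _ _] _] := N_F_norm. Qed.

Lemma F_normN x : N (- x) = N x.
Proof.
have [[_ _ _ h _] _] := N_F_norm.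
have le y : N (- y) <= N y by rewrite -scaleN1r h // normrN1.
by apply/eqP; rewrite eq_le le -{1}[x]opprK le.
Qed.

Lemma F_norm_sum (I : Type) (r : seq I) (P : pred I) (v : I -> X) :
  N (\sum_(i <- r | P i) v i) <= \sum_(i <- r | P i) N (v i).
Proof.
elim/big_ind2 : _ => [|x a y b xa yb|//]; first by rewrite F_norm0.
by apply: le_trans (F_normD _ _) _; rewrite lerD.
Qed.

Lemma nbhs_F_norm (x : X) (U : set X) :
  nbhs x U <-> exists2 e : R, 0 < e & forall z, N (x - z) < e -> U z.
Proof.
have [_ ->] := N_F_norm; split=> [[e e0 h]|[e e0 h]]; exists e => //.
Qed.

Lemma cvg_F_norm (u : nat -> X) (l : X) : u @ \oo --> l ->
  forall e : R, 0 < e -> exists n0, forall n, (n0 <= n)%N -> N (l - u n) < e.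
Proof.
move=> ul e e0; have /ul[n0 _ h] : nbhs l [set z | N (l - z) < e].
  by apply/nbhs_F_norm; exists e.
by exists n0 => n /h.
Qed.

(** Completeness is known for the metric d. Both d and the F-norm are
  invariant under translations and have the same neighbourhoods of 0, so they
  have the same Cauchy sequences. *)
Lemma F_norm_complete (u : nat -> X) : frechet_space R X ->
  (forall e : R, 0 < e -> exists n0 : nat,
     forall m n : nat, (n0 <= m)%N -> (m <= n)%N -> N (u n - u m) < e) ->
  exists l : X, u @ \oo --> l.
Proof.
move=> [d [[_ _ dC _] dD dtop dcomp]] uC; apply: dcomp => e e0.
have : nbhs (0 : X) [set z | d 0 z < e] by rewrite dtop; exists e.
move=> /nbhs_F_norm[e' e'0 h]; have [n0 hn0] := uC e' e'0.
exists n0.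
have main m n : (n0 <= m)%N -> (m <= n)%N -> d (u m) (u n) < e.
  move=> m0 mn; rewrite -[u m]add0r -[u n](subrK (u m)) dD.
  by apply: h; rewrite sub0r F_normN hn0.
move=> m n m0 n0n; have [mn|/ltnW nm] := leqP m n; first exact: main.
by rewrite dC main.
Qed.

Lemma uncond_cvg_uniformly_seq (x : nat -> nat -> X) (e : R) :
  uncond_cvg_uniformly N x -> 0 < e -> exists n0, forall s : seq nat,
    uniq s -> all (leq n0) s -> forall m, N (\sum_(n <- s) x m n) < e.
Proof.
move=> xC e0; have [n0 h] := xC e e0; exists n0 => s us /allP sn0 m.
have ps : perm_eq s [fset k in s]%fset.
  by apply: uniq_perm; rewrite ?fset_uniq // => k; rewrite in_fset.
by rewrite (perm_big _ ps) h // => n; rewrite in_fset => /sn0.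
Qed.

Lemma sum_halves_le (n : nat) : \sum_(q < n) (2^-1 : R) ^+ q <= 2.
Proof.
suff -> : \sum_(q < n) (2^-1 : R) ^+ q = 2 - 2 * 2^-1 ^+ n.
  by rewrite gerBl mulr_ge0 // exprn_ge0 // invr_ge0.
elim: n => [|n ih]; first by rewrite big_ord0 expr0; lra.
rewrite big_ord_recr /= ih exprS; lra.
Qed.

Lemma halves_lt (C e : R) : 0 < e ->
  exists P0, forall P, (P0 <= P)%N -> C * 2^-1 ^+ P < e.
Proof.
move=> e0; have h : C * (2^-1 : R) ^+ P @[P --> \oo] --> C * 0.
  by apply: cvgMr; apply: cvg_expr; rewrite ger0_norm ?invr_ge0 // invf_lt1 //; lra.
rewrite mulr0 in h; have [P0 _ hP] := cvgr_lt _ h _ e0.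
by exists P0 => P /hP.
Qed.

(** A bound 4^-(max P q) for the part of the sum of index q makes the whole
  sum small in P and summable in q, because 4^-(max P q) <= 2^-P * 2^-q. *)
Lemma F_norm_sum_by_index (delta : nat -> nat) (r : seq nat) (v : nat -> X)
    (P : nat) :
  (forall q, N (\sum_(k <- r | delta k == q) v k) <=
     2^-1 ^+ maxn P q * 2^-1 ^+ maxn P q) ->
  N (\sum_(k <- r) v k) <= 2 * 2^-1 ^+ P.
Proof.
move=> h.
(* only indices below Q occur in r *)
pose Q := (\max_(k <- r) delta k).+1.
have -> : \sum_(k <- r) v k = \sum_(q < Q) \sum_(k <- r | delta k == q) v k.
  under [in RHS]eq_bigr do rewrite big_mkcond.
  rewrite exchange_big /= big_seq [RHS]big_seq; apply: eq_bigr => k kr.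
  have kQ : (delta k < Q)%N by rewrite ltnS leq_bigmax_seq.
  rewrite (bigD1 (Ordinal kQ)) //= eqxx big1 ?addr0 // => q.
  by rewrite -val_eqE /= eq_sym => /negbTE ->.
apply: le_trans (F_norm_sum _ _ _) _.
apply: (@le_trans _ _ (\sum_(q < Q) 2^-1 ^+ P * 2^-1 ^+ q)); last first.
  by rewrite -mulr_sumr mulrC ler_wpM2r ?sum_halves_le ?exprn_ge0 ?invr_ge0.
apply: ler_sum => q _; apply: le_trans (h q) _.
have half01 : 0 <= (2^-1 : R) <= 1 by rewrite invr_ge0 invf_le1 //; lra.
have [_ half1] := andP half01.
by rewrite ler_pM ?exprn_ge0 ?invr_ge0 // ler_wiXn2l ?invr_ge0 ?leq_max ?leqnn ?orbT.
Qed.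

End FNorm.

(** * The universal vector *)

Section UniversalVector.
Context {R : realType} {K : numFieldType} {X : tvsType K}.
Variables (N : X -> R) (T : nat -> {linear X -> X}) (S : nat -> X -> X).
Hypotheses (X_frechet : frechet_space R X) (N_F_norm : F_norm_defining_topology N)
  (T_continuous : forall n, continuous (T n)).

(** The criterion at y, up to e: the finite sums over indices not smaller than
  n0 of its three series, and its approximation T_n S_n y ~ y for n >= n0. *)
Definition small_tails (y : X) (e : R) (n0 : nat) : Prop :=
  (forall s : seq nat, uniq s -> all (leq n0) s ->
    [/\ forall m, N (\sum_(n <- s) if (n <= m)%N then T m (S (m - n)%N y) else 0) < e,
        forall m, N (\sum_(n <- s) T m (S (m + n)%N y)) < e &
        N (\sum_(n <- s) S n y) < e]) /\
  (forall n, (n0 <= n)%N -> N (T n (S n y) - y) < e).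

Lemma small_tails_le y e n0 n1 : (n0 <= n1)%N ->
  small_tails y e n0 -> small_tails y e n1.
Proof.
move=> n01 [h1 h2]; split=> [s us /allP sn1|n n1n].
  by apply: h1 => //; apply/allP => k /sn1; exact: leq_trans.
by apply: h2; exact: leq_trans n1n.
Qed.

Lemma exists_small_tails y e : 0 < e ->
  uncond_cvg_uniformly N
    (fun m n => if (n <= m)%N then T m (S (m - n)%N y) else 0) ->
  uncond_cvg_uniformly N (fun m n => T m (S (m + n)%N y)) ->
  uncond_cvg N (fun n => S n y) ->
  T n (S n y) @[n --> \oo] --> y ->
  exists n0, small_tails y e n0.
Proof.
move=> e0 /(uncond_cvg_uniformly_seq)/(_ e0)[n1 h1].
move=> /(uncond_cvg_uniformly_seq)/(_ e0)[n2 h2].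
move=> /(uncond_cvg_uniformly_seq)/(_ e0)[n3 h3].
move=> /(cvg_F_norm N_F_norm)/(_ _ e0)[n4 h4].
exists (n1 + n2 + n3 + n4)%N; split=> [s us /allP ss|n hn].
  by split=> [m|m|]; [apply: h1|apply: h2|apply: (h3 _ _ _ 0%N)] => //;
    apply/allP => k /ss /= ?; lia.
by rewrite -opprB F_normN // h4 //; lia.
Qed.

Variables (y : nat -> X) (n0 : nat -> nat) (E : nat -> set nat).
Let eps (M : nat) : R := 2^-1 ^+ M * 2^-1 ^+ M.
Hypothesis y_tails : forall q M, (q <= M)%N -> small_tails (y q) (eps M) (n0 M).
Hypothesis E_large : forall p n, E p n -> (n0 p <= n)%N.
Hypothesis E_separated : forall p q n m : nat, (p, n) <> (q, m) ->
  E p n -> E q m -> (n0 (maxn p q) <= n - m + (m - n))%N.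
Hypothesis n0_gt0 : forall p, (0 < n0 p)%N.

(** The sum x = sum_k z_k has a term z_k = S_k (y_q) for each k in E q. Its
  convergence and the size of T_n (z_0 + ... + z_(n-1)) and of
  T_n (z_(n+1) + ...) for n in E p have the same proof: grouped by q, the
  terms form a sum of one of the series of the criterion, over indices at
  least n0 (max P q), with P = p for the last two. These indices are k itself,
  n - k and k - n, and for the last two this is the separation of n from k. *)
Lemma universal_vector : exists x : X, forall p n, E p n ->
  N (T n x - y p) < 6 * 2^-1 ^+ p.
Proof.
have /choice[delta deltaP] : forall k, exists q, forall q', E q' k -> q = q'.
  move=> k; have [[q qk]|nE] := pselect (exists q, E q k); last first.
    by exists 0%N => q' q'k; exfalso; apply: nE; exists q'.
  exists q => q' q'k; apply: contrapT => qq'.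
  have ne : (q, k) <> (q', k) by case.
  have := E_separated ne qk q'k; have := n0_gt0 (maxn q q'); lia.
pose act k := `[< E (delta k) k >].
pose z k := if act k then S k (y (delta k)) else 0.
(* the common estimate; L is the identity or some T_n *)
have sum_z (L : {linear X -> X}) P (r : seq nat) :
    (forall q (s : seq nat), uniq s -> {subset s <= r} -> (forall k, k \in s -> E q k) ->
      N (\sum_(k <- s) L (S k (y q))) < eps (maxn P q)) ->
    uniq r -> N (L (\sum_(k <- r) z k)) <= 2 * 2^-1 ^+ P.
  move=> h ur; have -> : L (\sum_(k <- r) z k) = \sum_(k <- r) L (z k) by rewrite linear_sum.
  apply: (@F_norm_sum_by_index _ _ _ _ N_F_norm delta r (fun k => L (z k))) => q.
  rewrite -/(eps _) ltW //.
  have -> : \sum_(k <- r | delta k == q) L (z k) =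
     \sum_(k <- [seq k <- r | (delta k == q) && act k]) L (S k (y q)).
    rewrite big_filter big_mkcondr /=; apply: eq_bigr => k /eqP kq.
    by rewrite /z kq; case: ifP => //; rewrite linear0.
  apply: h; first exact: filter_uniq.
    by move=> k; rewrite mem_filter => /andP[].
  by move=> k; rewrite mem_filter => /andP[/andP[/eqP <- /asboolP]].
pose X_ M := \sum_(0 <= k < M) z k.
have [x Xx] : exists x : X, X_ @ \oo --> x.
  apply: (F_norm_complete N_F_norm X_frechet) => e e_gt0.
  have [P0 hP0] := halves_lt 2 e_gt0.
  exists (n0 P0) => a b Pa ab.
  rewrite /X_ (@big_cat_nat _ _ _ a 0 b) //= addrAC subrr add0r.
  apply: le_lt_trans (hP0 P0 (leqnn _)).
  apply: (sum_z idfun) => [q s us sab sE|]; last exact: iota_uniq.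
  have [|h _] := @y_tails q (maxn P0 q); first by rewrite leq_maxr.
  have [|_ _ //] := h s us.
  apply/allP => k ks; have := E_large (sE _ ks); have := sab _ ks.
  by rewrite mem_index_iota /=; case: (leqP P0 q) => _; lia.
exists x => p n pn.
have dn : delta n = p := deltaP n p pn.
have zn : z n = S n (y p) by rewrite /z /act dn asboolT.
have TSy : N (T n (S n (y p)) - y p) < 2^-1 ^+ p.
  have [_ h] := y_tails (leqnn p).
  apply: lt_le_trans (h n (E_large pn)) _.
  by rewrite /eps ler_piMr ?exprn_ge0 ?exprn_ile1 ?invr_ge0 // invf_le1 //; lra.
(* reindexed by n - k: the first series of the criterion *)
have before : N (T n (\sum_(0 <= k < n) z k)) <= 2 * 2^-1 ^+ p.
  apply: (sum_z (T n)) => [q s us sab sE|]; last exact: iota_uniq.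
  have [|h _] := @y_tails q (maxn p q); first by rewrite leq_maxr.
  have sn k : k \in s -> (k < n)%N by move=> /sab; rewrite mem_index_iota.
  have [||/(_ n) + _ _] := h [seq (n - k)%N | k <- s].
  - rewrite map_inj_in_uniq // => a b /sn an /sn bn; lia.
  - apply/allP => _ /mapP[k ks ->] /=; have kn := sn k ks.
    have ne : (p, n) <> (q, k) by case=> _ nk; lia.
    by have := E_separated ne pn (sE k ks); lia.
  rewrite big_map big_seq (eq_bigr (fun k => T n (S k (y q)))).
    by rewrite -big_seq.
  by move=> k ks; rewrite leq_subr subKn // ltnW // sn.
(* reindexed by k - n: the second series of the criterion *)
have after M : N (T n (\sum_(n.+1 <= k < M) z k)) <= 2 * 2^-1 ^+ p.
  apply: (sum_z (T n)) => [q s us sab sE|]; last exact: iota_uniq.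
  have [|h _] := @y_tails q (maxn p q); first by rewrite leq_maxr.
  have sn k : k \in s -> (n < k)%N by move=> /sab; rewrite mem_index_iota => /andP[].
  have [||_ /(_ n) + _] := h [seq (k - n)%N | k <- s].
  - rewrite map_inj_in_uniq // => a b /sn an /sn bn; lia.
  - apply/allP => _ /mapP[k ks ->] /=; have kn := sn k ks.
    have ne : (p, n) <> (q, k) by case=> _ nk; lia.
    by have := E_separated ne pn (sE k ks); lia.
  rewrite big_map big_seq (eq_bigr (fun k => T n (S k (y q)))).
    by rewrite -big_seq.
  by move=> k ks; rewrite subnKC // ltnW // sn.
have TX : T n (X_ M) @[M --> \oo] --> T n x.
  by apply: continuous_cvg; [exact: T_continuous|exact: Xx].
have half0 : 0 < (2^-1 : R) ^+ p by rewrite exprn_gt0 // invr_gt0.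
have [M0 /(_ (maxn M0 n.+1) (leq_maxl _ _))] := cvg_F_norm N_F_norm TX half0.
set M := maxn M0 n.+1 => hM.
have nM : (n < M)%N by rewrite leq_max leqnn orbT.
have XE : X_ M = \sum_(0 <= k < n) z k + (z n + \sum_(n.+1 <= k < M) z k).
  by rewrite /X_ (@big_cat_nat _ _ _ n 0 M) /= ?(big_ltn nM) // ltnW.
have -> : T n x - y p = (T n x - T n (X_ M)) + T n (\sum_(0 <= k < n) z k) +
    (T n (S n (y p)) - y p) + T n (\sum_(n.+1 <= k < M) z k).
  have -> : T n (X_ M) = T n (\sum_(0 <= k < n) z k) +
      (T n (S n (y p)) + T n (\sum_(n.+1 <= k < M) z k)).
    by rewrite XE zn !linearD.
  set u := T n x; set a := T n (\sum_(0 <= k < n) _).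
  set b := T n (S n _); set c := T n (\sum_(n.+1 <= k < M) _).
  rewrite -[in LHS](subrK (a + (b + c)) u) -!addrA; do 4 congr (_ + _).
  exact: addrC.
have := F_normD N_F_norm (T n x - T n (X_ M)) (T n (\sum_(0 <= k < n) z k)).
have := F_normD N_F_norm (T n x - T n (X_ M) + T n (\sum_(0 <= k < n) z k))
  (T n (S n (y p)) - y p).
have := F_normD N_F_norm (T n x - T n (X_ M) + T n (\sum_(0 <= k < n) z k) +
  (T n (S n (y p)) - y p)) (T n (\sum_(n.+1 <= k < M) z k)).
have := after M; move: hM before TSy half0; lra.
Qed.

End UniversalVector.

(** * Dense sequences and conclusion *)

Section DenseSequence.
Context {R : realType} {K : numFieldType} {X : tvsType K}.
Variable N : X -> R.
Hypothesis N_F_norm : F_norm_defining_topology N.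

Lemma dense_F_norm (A : set X) (x : X) (e : R) : dense A -> 0 < e ->
  exists2 y, A y & N (x - y) < e.
Proof.
move=> Ad e0; have xU : nbhs x [set z | N (x - z) < e].
  by apply/(nbhs_F_norm N_F_norm); exists e.
have [|y [/interior_subset yU Ay]] := Ad _ _ (@open_interior _ [set z | N (x - z) < e]).
  by exists x.
by exists y.
Qed.

(** The points y_p have to be good approximations with p large, so each point
  a_i of a countable dense set must be approached by y_p for infinitely many
  p: the index i is the 2-adic valuation of p + 1. *)
Lemma exists_dense_seq_in (Y0 : set X) : separable X -> dense Y0 ->
  exists y : nat -> X, (forall p, Y0 (y p)) /\
    forall x (e : R), 0 < e -> exists p, N (x - y p) + 6 * 2^-1 ^+ p < e.
Proof.
move=> [A /countable_injP[f fI] Ad] Yd.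
have /choice[a aP] : forall i, exists b, forall x, A x -> f x = i -> x = b.
  move=> i; have [[b [Ab bi]]|nb] := pselect (exists b, A b /\ f b = i).
    by exists b => x Ax xi; apply: fI; rewrite ?inE // bi.
  by exists 0 => x Ax xi; exfalso; apply: nb; exists x.
have half0 p : 0 < (2^-1 : R) ^+ p by rewrite exprn_gt0 // invr_gt0.
have /choice[y yP] : forall p, exists y, Y0 y /\ N (a (logn 2 p.+1) - y) < 2^-1 ^+ p.
  by move=> p; have [y ? ?] := dense_F_norm (a (logn 2 p.+1)) Yd (half0 p); exists y; split.
exists y; split=> [p|x e e0]; first by have [] := yP p.
have e2 : 0 < e / 2 by rewrite divr_gt0.
have [b Ab bx] := dense_F_norm x Ad e2.
(* 7 = 6 + 1, the 1 being the distance from y_p to b *)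
have [P0 hP0] := halves_lt 7 e2.
pose p := (2 ^ f b * (P0.*2.+1)).-1.
have pE : p.+1 = (2 ^ f b * P0.*2.+1)%N by rewrite prednK // muln_gt0 expn_gt0.
have Pp : (P0 <= p)%N.
  have f0 : (0 < 2 ^ f b)%N by rewrite expn_gt0.
  by have := leq_pmull P0.*2.+1 f0; lia.
have lp : logn 2 p.+1 = f b.
  rewrite pE lognM ?expn_gt0 // pfactorK // [X in (_ + X)%N]logn_coprime ?addn0 //.
  by rewrite coprime2n /= odd_double.
have [_] := yP p; rewrite lp -(aP _ _ Ab erefl) => bp.
exists p; have := hP0 p Pp.
have -> : x - y p = (x - b) + (b - y p) by rewrite addrA subrK.
have := F_normD N_F_norm (x - b) (b - y p); lra.
Qed.

End DenseSequence.

(** The rank n0 M works for the first M + 1 vectors y_q together. The sets E p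
  depend on it, but not on alpha: this is why one vector serves all weights. *)
Lemma common_universal_vector (R : realType) (K : numFieldType) (X : tvsType K)
    (N : X -> R) (T : nat -> {linear X -> X}) :
  frechet_space R X -> separable X -> F_norm_defining_topology N ->
  (forall n, continuous (T n)) -> frequent_universality_criterion N T ->
  \bigcap_(alpha in (D_family : set (nat -> R))) freq_universal alpha T !=set0.
Proof.
move=> X_frechet X_separable N_F_norm T_continuous [Y0 [S [Y0_dense Y0P]]].
have [y [yY0 y_dense]] := exists_dense_seq_in N_F_norm X_separable Y0_dense.
have eps_gt0 M : 0 < (2^-1 : R) ^+ M * 2^-1 ^+ M.
  by rewrite mulr_gt0 // exprn_gt0 // invr_gt0.
have /choice[h hP] : forall qM : nat * nat, exists n0,
    small_tails N T S (y qM.1) (2^-1 ^+ qM.2 * 2^-1 ^+ qM.2) n0.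
  move=> [q M]; have [c1 c2 c3 c4] := Y0P _ (yY0 q).
  exact: exists_small_tails.
pose n0 M := (\sum_(q < M.+1) h (q : nat, M)).+1.
have [g gP] := exists_log_threshold R.
have n0_gt0 M : (0 < n0 M)%N by rewrite /n0.
have [E [E_large E_sep E_fills]] := exists_separated_sets g n0_gt0.
have y_tails q M : (q <= M)%N ->
    small_tails N T S (y q) (2^-1 ^+ M * 2^-1 ^+ M) (n0 M).
  move=> qM; apply: small_tails_le (hP (q, M)).
  by rewrite /n0 (bigD1 (Ordinal (qM : (q < M.+1)%N))) //= leqW // leq_addr.
have [x xP] := universal_vector X_frechet N_F_norm T_continuous y_tails E_large
  E_sep n0_gt0.
exists x => alpha aD U Uo [u Uu].
have /(nbhs_F_norm N_F_norm)[e e0 eU] : nbhs u U by apply: open_nbhs_nbhs.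
have [p hp] := y_dense u e e0.
apply: (lower_density_gt0 gP) aD.
apply: fills_short_windowsW (E_fills p) => n /xP pn; apply: eU.
have -> : u - T n x = (u - y p) - (T n x - y p) by rewrite opprB addrA subrK.
apply: le_lt_trans (F_normD N_F_norm _ _) _; rewrite F_normN //; lra.
Qed.

Theorem proposition4p8 (R : realType) (k : ground_field)
    (X : tvsType (scalars R k)) (X_frechet : frechet_space R X)
    (X_separable : separable X)
    (N : X -> R) (N_F_norm : F_norm_defining_topology N)
    (T : nat -> {linear X -> X}) (T_continuous : forall n, continuous (T n))
    (T_FUC : frequent_universality_criterion N T) :
  \bigcap_(alpha in (D_family : set (nat -> R))) freq_universal alpha T !=set0.
Proof.
exact: (common_universal_vector X_frechet X_separable N_F_norm T_continuous T_FUC).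
Qed.
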